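(* Let $c,k$ be positive integers with $ck\ge 2$. For every online $c$-coloring algorithm there exists an ordered set of $N=2^{ck}-1$ points in the plane such that, when these points are presented to the algorithm one by one in this order, the algorithm produces a coloring with a monochromatic wedge of size at least $k+1$.
   Context: A wedge is a set $\{(x,y)\in\mathbb{R}^2 : x<x_0,\ y<y_0\}$ with fixed apex $(x_0,y_0)$, where $x_0=\infty$ and $y_0=\infty$ are also allowed. Given a finite set of colored points in the plane, the size of a wedge is the number of points of the set it contains, and a wedge is monochromatic if all the points of the set it contains have the same color. An online $c$-coloring algorithm is a (deterministic) rule that, when distinct points $p_1,p_2,\ldots$ of the plane arrive one at a time, assigns to $p_i$ on its arrival one of $c$ colors, knowing only $p_1,\ldots,p_i$ and the colors of $p_1,\dots,p_{i-1}$; colors are never changed later and nothing is known about future points. No properness of the coloring is assumed. *)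

(* Defs.v *)
From HB Require Import structures.
From mathcomp Require Import all_boot all_order all_algebra.
From mathcomp Require Import all_reals.

Set Implicit Arguments.
Unset Strict Implicit.
Unset Printing Implicit Defensive.

Import Order.TTheory GRing.Theory Num.Theory.

Local Open Scope ring_scope.

(* Points presented so far, in order of arrival, each with its final color. *)
Definition colored_points (R : realType) (c : nat) : Type :=
  seq ((R * R) * 'I_c).

(* [A h p] is the color given to the arriving point [p], where [h] lists the
   earlier points and their colors.  The values of [A] when [p] or [h] repeats
   a point are never used on sequences of distinct points. *)
Definition online_algorithm (R : realType) (c : nat) : Type :=
  colored_points R c -> R * R -> 'I_c.

Definition online_coloring (R : realType) (c : nat)
    (A : online_algorithm R c) (ps : seq (R * R)) : colored_points R c :=
  foldl (fun h p => rcons h (p, A h p)) [::] ps.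

(* [+oo] stands for an infinite apex coordinate.  The value [-oo] is
   not a legal coordinate and is excluded by [is_wedge]. *)
Definition wedge (R : realType) (x0 y0 : \bar R) : {pred R * R} :=
  [pred p : R * R | (p.1%:E < x0)%E && (p.2%:E < y0)%E].

Definition is_wedge (R : realType) (W : {pred R * R}) : Prop :=
  exists x0 y0 : \bar R,
    [/\ x0 != -oo%E, y0 != -oo%E & W =i wedge x0 y0].

(* This counts list entries, hence points when the points of [s] are distinct. *)
Definition wedge_size (R : realType) (c : nat)
    (W : {pred R * R}) (s : colored_points R c) : nat :=
  count (fun q => q.1 \in W) s.

Definition monochromatic (R : realType) (c : nat)
    (W : {pred R * R}) (s : colored_points R c) : Prop :=
  forall q r, q \in s -> r \in s -> q.1 \in W -> r.1 \in W -> q.2 = r.2.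

(* Main.v *)
Require Import Defs.
From HB Require Import structures.
From mathcomp Require Import all_boot all_order all_algebra.
From mathcomp Require Import all_reals.
From mathcomp Require Import lra zify.

(** Color [j] is represented with multiplicity [v j] when some monochromatic
wedge of color [j] has size at least [v j].  The adversary raises the total
[\sum_j v j] one unit at a time, working inside an arbitrary open box so that
strategies can be nested.

To go from total [s] to total [s + 1], play the strategy for [s] twice, in an
upper left box and in a lower right box.  No point of one box is dominated by
the upper right corner of the other, so wedges with apex in one box do not see
the other box.  Let [v] and [w] be the sizes obtained.  If [w j < v j] for some
color [j], keeping the larger size for every color gives a total above
[\sum_j w j].  Otherwise [v <= w] everywhere, and one more point is placed to
the lower left of everything in the upper left box: whatever color [i] it gets,
it enlarges the wedge of that color there, which now has size [v i + 1], while
every other color is at least as well represented in the lower right box, which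
the new point leaves intact ([forcible_succ]).

Two incomparable points already force total [2]: if their colors agree, a
wedge contains both ([forcible_two]).  Hence [3 * 2 ^ (s - 2) - 1] points
force total [s] ([forcible_exp]); an induction started from one point and total
[1] would give [2 ^ s - 1], which leaves no room for the last point.
With total [c * k], either some color has a wedge of size above [k], or all
sizes equal [k], and then one point below everything enlarges one of them to
[k + 1] ([force_wedge_above]).
This takes at most [3 * 2 ^ (c * k - 2) <= 2 ^ (c * k) - 1] points; the rest
are placed so far to the right that they are outside the wedge ([pad_far]). *)

Set Implicit Arguments.
Unset Strict Implicit.
Unset Printing Implicit Defensive.

Import Order.TTheory GRing.Theory Num.Theory.

Local Open Scope ring_scope.

Lemma sum_ltn_witness (I : finType) (v u : I -> nat) (i : I) :
    (forall j, (v j <= u j)%N) -> (v i < u i)%N ->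
  (\sum_j v j < \sum_j u j)%N.
Proof.
move=> le_vu lt_i; rewrite (bigD1 i) //= [X in (_ < X)%N](bigD1 i) //=.
by rewrite -addSn leq_add // leq_sum.
Qed.

Section Adversary.

Variables (R : realType) (c : nat) (A : online_algorithm R c).
Implicit Types (h cs : colored_points R c) (ps : seq (R * R)) (p : R * R).
Implicit Types (i j : 'I_c) (x y : R) (m n s : nat).

(** * Playing from a given history *)

(** Only the new points are listed, so that the analysis of a sub-strategy
does not mention what was played before it. *)
Fixpoint play h ps : colored_points R c :=
  if ps is p :: ps' then (p, A h p) :: play (rcons h (p, A h p)) ps' else [::].

Lemma online_coloringE ps : online_coloring A ps = play [::] ps.
Proof.
suff foldlE h : foldl (fun h p => rcons h (p, A h p)) h ps = h ++ play h ps.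
  exact: foldlE.
by elim: ps h => [|p ps IH] h /=; rewrite ?cats0 // IH cat_rcons.
Qed.

Lemma play_cat h ps qs : play h (ps ++ qs) = play h ps ++ play (h ++ play h ps) qs.
Proof.
elim: ps h => [|p ps IH] h /=; first by rewrite cats0.
by rewrite IH cat_rcons.
Qed.

Lemma map_fst_play h ps : [seq q.1 | q <- play h ps] = ps.
Proof. by elim: ps h => //= p ps IH h; rewrite IH. Qed.

(** * Wedges of a given color *)

Lemma in_wedge x y p : (p \in wedge x%:E y%:E) = (p.1 < x) && (p.2 < y).
Proof. by rewrite inE !lte_fin. Qed.

(** With [m = 0] this also covers wedges that contain no point. *)
Definition color_wedge j x y m cs : Prop :=
  (forall q, q \in cs -> q.1 \in wedge x%:E y%:E -> q.2 = j) /\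
  (m <= wedge_size (wedge x%:E y%:E) cs)%N.

Lemma color_wedge_cat j x y m n cs cs' :
    color_wedge j x y m cs -> color_wedge j x y n cs' ->
  color_wedge j x y (m + n) (cs ++ cs').
Proof.
move=> [mono le_m] [mono' le_n]; split.
  by move=> q; rewrite mem_cat => /orP[/mono | /mono'].
by rewrite /wedge_size count_cat leq_add.
Qed.

Lemma color_wedge1 j x y p :
  p.1 < x -> p.2 < y -> color_wedge j x y 1 [:: (p, j)].
Proof.
move=> ltx lty; split; first by move=> q; rewrite inE => /eqP->.
by rewrite /wedge_size /= in_wedge ltx lty.
Qed.

Lemma color_wedge_outside j x y h ps :
    (forall p, p \in ps -> (x <= p.1) || (y <= p.2)) ->
  color_wedge j x y 0 (play h ps).
Proof.
move=> out; split=> // q q_in; rewrite in_wedge => /andP[ltx lty].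
have /out : q.1 \in ps by rewrite -(map_fst_play h ps) map_f.
by rewrite !leNgt ltx lty.
Qed.

(** * Forcing a large total *)

Definition in_box (a b d e : R) p := [&& a < p.1, p.1 < b, d < p.2 & p.2 < e].

(** The apex is confined to the closed box: the upper bounds keep the points
of other boxes out of the wedge, and the lower bounds make any point strictly
below the lower left corner fall into it. *)
Definition forcible s n : Prop :=
  forall h (a b d e : R), a < b -> d < e ->
  exists ps (v : 'I_c -> nat),
    [/\ uniq ps, (size ps <= n)%N, all (in_box a b d e) ps,
        (s <= \sum_j v j)%N &
        forall j, exists x y, [/\ a <= x <= b, d <= y <= e &
                                  color_wedge j x y (v j) (play h ps)]].

Lemma three_between (a b : R) : a < b ->
  exists x1 x2 x3, [/\ a < x1, x1 < x2, x2 < x3 & x3 < b].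
Proof.
move=> ab; exists (a + (b - a) / 4), (a + (b - a) / 2), (a + (b - a) * 3 / 4).
by split; lra.
Qed.

Lemma forcible_two : forcible 2 2.
Proof.
move=> h a b d e ab de.
have [x1 [x2 [x3 [ax1 x12 x23 x3b]]]] := three_between ab.
have [y1 [y2 [y3 [dy1 y12 y23 y3e]]]] := three_between de.
pose p := (x1, y3); pose i := A h p; pose h' := rcons h (p, i).
pose q := (x3, y1); pose j := A h' q.
exists [:: p; q], (fun l => (l == i) + (l == j))%N; split=> //=.
- by rewrite inE xpair_eqE andbT negb_and lt_eqF // (lt_trans x12).
- by rewrite /in_box /=; apply/and3P; split=> //; apply/and4P; split=> //; lra.
- by rewrite big_split /= -!big_mkcond /= !big_pred1_eq.
move=> l; rewrite -/i -/h' -/j.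
have inside z k x y : l = k -> z.1 < x -> z.2 < y -> color_wedge l x y 1 [:: (z, k)].
  by move=> <-; apply: color_wedge1.
have outside z k x y : (x <= z.1) || (y <= z.2) -> color_wedge l x y 0 [:: (z, k)].
  move=> out; split=> // z'; rewrite inE => /eqP-> /=.
  by rewrite in_wedge !ltNge -negb_or out.
rewrite -[_ :: _]/([:: (p, i)] ++ [:: (q, j)]).
case: (eqVneq l i) => [li | _]; case: (eqVneq l j) => [lj | _].
- exists b, e; split; [lra | lra |].
  by apply: color_wedge_cat; apply: inside => //=; lra.
- exists x2, e; split; [lra | lra |].
  by apply: color_wedge_cat; [apply: inside => //= | apply: outside => /=]; lra.
- exists b, y2; split; [lra | lra |].
  by apply: color_wedge_cat; [apply: outside => /= | apply: inside => //=]; lra.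
- exists a, d; split; [lra | lra |].
  by apply: color_wedge_cat; apply: outside => /=; lra.
Qed.

Lemma forcible_succ s n : forcible s n -> forcible s.+1 (n + n).+1.
Proof.
move=> force h a b d e ab de.
have [x1 [x2 [x3 [ax1 x12 x23 x3b]]]] := three_between ab.
have [y1 [y2 [y3 [dy1 y12 y23 y3e]]]] := three_between de.
(* The upper left box leaves room for the point (x1, y2) below its corner. *)
have [ps [v [uniq_ps le_ps box_ps le_v wedge_ps]]] := force h _ _ _ _ x23 y3e.
pose h' := h ++ play h ps.
have [qs [w [uniq_qs le_qs box_qs le_w wedge_qs]]] := force h' _ _ _ _ x3b dy1.
have {}box_ps p : p \in ps -> in_box x2 x3 y3 e p by move/(allP box_ps).
have {}box_qs p : p \in qs -> in_box x3 b d y1 p by move/(allP box_qs).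
have uniq_pq : uniq (ps ++ qs).
  rewrite cat_uniq uniq_ps uniq_qs andbT; apply/hasPn => p /box_qs /and4P[? _ _ _].
  by apply/negP => /box_ps /and4P[_ ? _ _]; lra.
have box_pq : all (in_box a b d e) (ps ++ qs).
  apply/allP => p; rewrite mem_cat => /orP[/box_ps | /box_qs] /and4P[? ? ? ?];
  by apply/and4P; split; lra.
have play_pq : play h (ps ++ qs) = play h ps ++ play h' qs by rewrite play_cat.
have wedge_l j : exists x y, [/\ x2 <= x <= x3, y3 <= y <= e &
    color_wedge j x y (v j) (play h (ps ++ qs))].
  have [x [y [xb yb cw]]] := wedge_ps j; exists x, y; split=> //.
  rewrite play_pq -[v j]addn0; apply: color_wedge_cat => //.
  by apply: color_wedge_outside => p /box_qs /and4P[? ? ? ?]; lra.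
have wedge_r j : exists x y, [/\ x3 <= x <= b, d <= y <= y1 &
    color_wedge j x y (w j) (play h (ps ++ qs))].
  have [x [y [xb yb cw]]] := wedge_qs j; exists x, y; split=> //.
  rewrite play_pq -[w j]add0n; apply: color_wedge_cat => //.
  by apply: color_wedge_outside => p /box_ps /and4P[? ? ? ?]; lra.
case: (boolP [forall j, (v j <= w j)%N]) => [/forallP le_vw | ]; last first.
  rewrite negb_forall => /existsP[i]; rewrite -ltnNge => lt_i.
  exists (ps ++ qs), (fun j => maxn (v j) (w j)); split=> //.
  - by rewrite size_cat leqW // leq_add.
  - apply: leq_ltn_trans le_w _; apply: (sum_ltn_witness (i := i)) => [j|].
      exact: leq_maxr.
    by rewrite leq_max lt_i.
  - move=> j; case: (leqP (v j) (w j)) => _.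
      by have [x [y [? ? cw]]] := wedge_r j; exists x, y; split=> //; lra.
    by have [x [y [? ? cw]]] := wedge_l j; exists x, y; split=> //; lra.
pose p := (x1, y2); pose i := A (h ++ play h (ps ++ qs)) p.
exists ((ps ++ qs) ++ [:: p]), (fun j => if j == i then (v i).+1 else w j).
have play_p : play h ((ps ++ qs) ++ [:: p]) = play h (ps ++ qs) ++ [:: (p, i)].
  by rewrite play_cat.
split.
- rewrite cats1 rcons_uniq uniq_pq andbT mem_cat; apply/negP.
  by case/orP => [/box_ps | /box_qs] /and4P[/= ? ? ? ?]; lra.
- by rewrite cats1 size_rcons size_cat ltnS leq_add.
- by rewrite all_cat box_pq /= andbT; apply/and4P; split=> /=; lra.
- apply: leq_ltn_trans le_v _; apply: (sum_ltn_witness (i := i)) => [j|].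
    by case: eqP => [->|_]; rewrite ?leqnSn ?le_vw.
  by rewrite eqxx.
move=> j; rewrite play_p; case: eqP => [->|_].
  have [x [y [? ? cw]]] := wedge_l i; exists x, y; split; [lra | lra |].
  rewrite -addn1; apply: color_wedge_cat => //.
  by apply: color_wedge1 => /=; lra.
have [x [y [? ? cw]]] := wedge_r j; exists x, y; split; [lra | lra |].
rewrite -[w j]addn0; apply: color_wedge_cat => //.
apply: (@color_wedge_outside _ _ _ (h ++ play h (ps ++ qs)) [:: p]) => z.
by rewrite inE => /eqP-> /=; lra.
Qed.

Lemma forcible_exp s : forcible s.+2 (3 * 2 ^ s - 1).
Proof.
elim: s => [|s IH]; first exact: forcible_two.
have -> : (3 * 2 ^ s.+1 - 1 = ((3 * 2 ^ s - 1) + (3 * 2 ^ s - 1)).+1)%N.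
  by have := expn_gt0 2 s; rewrite expnS; lia.
exact: forcible_succ.
Qed.

(** * A monochromatic wedge of size above k *)

(** When no color exceeds [k], the total [c * k] is reached only with size [k]
for every color, so the color of a point below everything does not matter. *)
Lemma force_wedge_above k n : forcible (c * k) n ->
  exists ps j x y,
    [/\ uniq ps, (size ps <= n.+1)%N, all (in_box (-1) 2 (-1) 2) ps,
        x < 2 /\ y < 2 & color_wedge j x y k.+1 (play [::] ps)].
Proof.
move=> /(_ [::] 0 1 0 1 ltr01 ltr01) [ps [v [uniq_ps le_n box_ps le_v wedge_ps]]].
have box_sub p : in_box 0 1 0 1 p -> in_box (-1) 2 (-1) 2 p.
  by move=> /and4P[? ? ? ?]; apply/and4P; split; lra.
have {}box_sub := sub_all box_sub box_ps.
case: (boolP [exists j, (k < v j)%N]) => [/existsP[j lt_k] | ].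
  have [x [y [? ? [mono le_j]]]] := wedge_ps j.
  exists ps, j, x, y; split=> //; first exact: leqW.
    by split; lra.
  by split=> //; apply: leq_trans le_j.
rewrite negb_exists => /forallP le_k.
have {}le_k j : (v j <= k)%N by rewrite leqNgt.
pose p : R * R := (- (1 / 2), - (1 / 2)); pose i := A (play [::] ps) p.
have vi : v i = k.
  apply/eqP; rewrite eqn_leq le_k leqNgt; apply/negP => lt_i.
  have := sum_ltn_witness le_k lt_i.
  by rewrite sum_nat_const card_ord ltnNge le_v.
have [x [y [? ? ]]] := wedge_ps i; rewrite {}vi => cw.
exists (ps ++ [:: p]), i, x, y; split.
- rewrite cats1 rcons_uniq uniq_ps andbT; apply/negP.
  by move=> /(allP box_ps) /and4P[/= ? ? ? ?]; lra.
- by rewrite cats1 size_rcons.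
- by rewrite all_cat box_sub /= andbT; apply/and4P; split=> /=; lra.
- by split; lra.
rewrite play_cat -addn1; apply: color_wedge_cat => //.
by apply: color_wedge1 => /=; lra.
Qed.

Lemma pad_far ps N : uniq ps -> all (in_box (-1) 2 (-1) 2) ps ->
    (size ps <= N)%N ->
  exists qs, [/\ uniq (ps ++ qs), size (ps ++ qs) = N &
                 forall q, q \in qs -> 2 <= q.1].
Proof.
move=> uniq_ps /allP box_ps le_N.
pose far m : R * R := (2 + m%:R, 0).
have far_ge q : q \in map far (iota 0 (N - size ps)) -> 2 <= q.1.
  by case/mapP => m _ -> /=; rewrite lerDl ler0n.
exists (map far (iota 0 (N - size ps))); split=> //; last first.
  by rewrite size_cat size_map size_iota subnKC.
rewrite cat_uniq uniq_ps map_inj_uniq ?iota_uniq ?andbT.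
  apply/hasPn => q /far_ge ?; apply/negP => /box_ps /and4P[? ? ? ?]; lra.
by move=> m m' [] /addrI /eqP; rewrite eqr_nat => /eqP.
Qed.

End Adversary.

Theorem theorem2 (R : realType) (c k : nat) (hc : (0 < c)%N) (hk : (0 < k)%N)
    (hck : (2 <= c * k)%N) (A : online_algorithm R c) :
  exists ps : seq (R * R),
    [/\ uniq ps,
        size ps = (2 ^ (c * k) - 1)%N &
        exists W : {pred R * R},
          [/\ is_wedge W,
              monochromatic W (online_coloring A ps) &
              (k + 1 <= wedge_size W (online_coloring A ps))%N]].
Proof.
have force := forcible_exp A (c * k - 2).
have ckE : ((c * k - 2).+2 = c * k)%N by rewrite -[in RHS](subnK hck) addn2.
rewrite ckE in force.
have [ps [j [x [y [uniq_ps le_ps box_ps [x2 y2] cw]]]]] := force_wedge_above force.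
have le_N : (size ps <= 2 ^ (c * k) - 1)%N.
  apply: leq_trans le_ps _; rewrite -[in X in (_ <= X)%N]ckE !expnS.
  by have := expn_gt0 2 (c * k - 2); lia.
have [qs [uniq_pq size_pq far]] := pad_far uniq_ps box_ps le_N.
exists (ps ++ qs); split=> //; exists (wedge x%:E y%:E).
have [mono size_W] : color_wedge j x y (k.+1 + 0) (online_coloring A (ps ++ qs)).
  rewrite online_coloringE play_cat; apply: color_wedge_cat => //.
  by apply: color_wedge_outside => q /far q2; rewrite (le_trans (ltW x2) q2).
split; first by exists x%:E, y%:E.
- by move=> q r qin rin /(mono _ qin)-> /(mono _ rin)->.
- by rewrite addn1 -[k.+1]addn0.
Qed.
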